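(* Let $(X,f)$ be a dynamical system (with nonempty compact Hausdorff phase space) such that $\Phi(\mathcal P(X,f))\neq E$, and let $\mathfrak B_0(X,f)$ be a skeleton of the category $\mathfrak B(X,f)$. The following statements are equivalent: (i) the dynamical system $(X,f)$ is indecomposable; (ii) the categories $\mathfrak B_0(X,f)$ and $\mathfrak L(\Sigma(X,f))$ are isomorphic.
   Context: Here $\mathbb N=\{1,2,\dots\}$. A dynamical system is a pair $(X,f)$ with $X$ a nonempty compact Hausdorff space and $f:X\to X$ a homeomorphism. A morphism $h:(X,f)\to(Y,g)$ is a continuous map $h:X\to Y$ with $h\circ f=g\circ h$; the category so obtained is $\mathcal K_0$. Topologically conjugate means isomorphic in $\mathcal K_0$. $(X,f)$ is indecomposable if whenever $X=X_1\cup X_2$, $X_1\cap X_2=\emptyset$, with $X_1,X_2$ closed and invariant ($f(X_i)=X_i$), then $X_1=\emptyset$ or $X_2=\emptyset$. A periodic partition of $(X,f)$ of length $m\in\mathbb N$ is a family $\{W_i\}_{i=0}^{m-1}$ of pairwise disjoint open-closed subsets of $X$ with union $X$, such that $f(W_{i-1})=W_i$ for $i=1,\dots,m-1$ and $f(W_{m-1})=W_0$. $\mathcal P(X,f)\subseteq\mathbb N$ is the set of lengths of all periodic partitions of $(X,f)$ (it contains $1$). An ultranatural number is a family $N=(N_p)_p$ indexed by primes $p$ with $N_p\in\{0,1,2,\dots\}\cup\{\infty\}$. $\Sigma$ is the set of ultranatural numbers, ordered by $M\le N$ iff $M_p\le N_p$ for all $p$; its least element is $E=(0)_p$. For nonempty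 $S\subseteq\mathbb N$, $\Phi(S)\in\Sigma$ is defined by $\Phi(S)_p=\sup\{k\ge 0: p^k \text{ divides some } a\in S\}$. An odometer: given a sequence $\{n_i\}_{i\in\mathbb N}$ of positive integers with $n_i\mid n_{i+1}$ (bounded sequences allowed), $A=\varprojlim \mathbb Z/n_i\mathbb Z$ (inverse limit of discrete cyclic groups along the maps $1\mapsto 1$, with the inverse limit topology) and $g(\vec a)=\vec a+\vec e$, $\vec e=(1,1,\dots)$; $(A,g)$ is the odometer constructed on $\{n_i\}$. $\mathcal A$ is the full subcategory of $\mathcal K_0$ whose objects are the dynamical systems topologically conjugate to odometers; $\mathcal A(X,f)$ is the full subcategory of $\mathcal A$ of objects $(A,g)$ with $\Phi(\mathcal P(A,g))\le\Phi(\mathcal P(X,f))$. The category $\mathfrak B(X,f)$: objects are pairs $(h,(A,g))$ with $(A,g)$ an object of $\mathcal A(X,f)$ and $h:(X,f)\to(A,g)$ a morphism; morphisms from $(h_1,(A_1,g_1))$ to $(h_2,(A_2,g_2))$ are the (triples given by) morphisms $\pi:(A_1,g_1)\to(A_2,g_2)$ with $h_2=\pi\circ h_1$. A skeleton of a category is a full subcategory containing exactly one representative of each isomorphism class of objects. $\Sigma(X,f)=\{N\in\Sigma: N\le\Phi(\mathcal P(X,f))\}$. $\mathfrak L(\Sigma(X,f))$ is the category whose objects are the elements of $\Sigma(X,f)$, with exactly one morphism $(M,N)$ from $M$ to $N$ if $M\ge N$ and none otherwise. Two categories are isomorphic if there is a covariant functor between them that is bijective on objects and morphisms. *)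

(* Defs.v *)
From mathcomp Require Import all_boot all_order all_algebra.
From mathcomp Require Import all_classical topology.

Set Implicit Arguments.
Unset Strict Implicit.
Unset Printing Implicit Defensive.

Import GRing.Theory.
Local Open Scope classical_set_scope.

Record category := Category {
  Obj : Type;
  Hom : Obj -> Obj -> Type;
  idm : forall a, Hom a a;
  compm : forall a b c, Hom b c -> Hom a b -> Hom a c;
  compm1m : forall a b (u : Hom a b), compm (idm b) u = u;
  compmm1 : forall a b (u : Hom a b), compm u (idm a) = u;
  compmA : forall a b c d (w : Hom c d) (v : Hom b c) (u : Hom a b),
    compm w (compm v u) = compm (compm w v) u }.
Arguments Hom [_] _ _.
Arguments idm [_] _.
Arguments compm [_ _ _ _] _ _.

Definition isomorphic (C : category) (a b : Obj C) : Prop :=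
  exists (u : Hom a b) (v : Hom b a), compm v u = idm a /\ compm u v = idm b.

Definition full_subcat (C : category) (P : Obj C -> Prop) : category :=
  @Category {a : Obj C | P a} (fun a b => Hom (sval a) (sval b))
    (fun a => idm (sval a)) (fun a b c v u => compm v u)
    (fun a b => @compm1m C (sval a) (sval b))
    (fun a b => @compmm1 C (sval a) (sval b))
    (fun a b c d => @compmA C (sval a) (sval b) (sval c) (sval d)).

(* P is the set of objects of a skeleton; objects are compared by Leibniz
   equality. *)
Definition is_skeleton (C : category) (P : Obj C -> Prop) : Prop :=
  forall a : Obj C, exists! b, P b /\ isomorphic a b.

Record functor (C D : category) := Functor {
  fobj : Obj C -> Obj D;
  fhom : forall a b, Hom a b -> Hom (fobj a) (fobj b);
  fhom_id : forall a, fhom (idm a) = idm (fobj a);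
  fhom_comp : forall a b c (v : Hom b c) (u : Hom a b),
    fhom (compm v u) = compm (fhom v) (fhom u) }.

Definition arrows (C : category) : Type :=
  {a : Obj C & {b : Obj C & Hom a b}}.

Definition farrows (C D : category) (F : functor C D) (u : arrows C) : arrows D :=
  existT _ (fobj F (projT1 u))
    (existT _ (fobj F (projT1 (projT2 u))) (fhom F (projT2 (projT2 u)))).

Definition isomorphic_categories (C D : category) : Prop :=
  exists F : functor C D, bijective (fobj F) /\ bijective (farrows F).

Definition homeomorphism (S T : topologicalType) (f : S -> T) : Prop :=
  continuous f /\ exists g : T -> S, [/\ continuous g, cancel f g & cancel g f].

Record dynsys := DynSys {
  space :> topologicalType;
  tmap : space -> space;
  space_nonempty : [set: space] !=set0;
  space_compact : compact [set: space];
  space_hausdorff : hausdorff_space space;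
  tmap_homeo : homeomorphism tmap }.
Arguments tmap : clear implicits.

Definition dynhom (X Y : dynsys) : Type :=
  {h : X -> Y | continuous h /\ h \o tmap X = tmap Y \o h}.

Lemma dynhom_id_subproof (X : dynsys) :
  continuous (@id X) /\ id \o tmap X = tmap X \o id.
Proof. by split=> // x. Qed.

Definition dynhom_id (X : dynsys) : dynhom X X := exist _ id (dynhom_id_subproof X).

Lemma dynhom_comp_subproof (X Y Z : dynsys) (k : dynhom Y Z) (h : dynhom X Y) :
  continuous (sval k \o sval h) /\
  (sval k \o sval h) \o tmap X = tmap Z \o (sval k \o sval h).
Proof.
case: k h => [k [kc ke]] [h [hc he]] /=; split.
  by move=> x; apply: continuous_comp; [exact: hc|exact: kc].
by rewrite -compA he compA ke -compA.
Qed.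

Definition dynhom_comp (X Y Z : dynsys) (k : dynhom Y Z) (h : dynhom X Y) :
  dynhom X Z := exist _ (sval k \o sval h) (dynhom_comp_subproof k h).

Lemma dynhom_eq (X Y : dynsys) (h k : dynhom X Y) : sval h = sval k -> h = k.
Proof. exact: eq_sig_hprop. Qed.

Lemma dynhom_comp1h (X Y : dynsys) (h : dynhom X Y) :
  dynhom_comp (dynhom_id Y) h = h.
Proof. exact: dynhom_eq. Qed.

Lemma dynhom_comph1 (X Y : dynsys) (h : dynhom X Y) :
  dynhom_comp h (dynhom_id X) = h.
Proof. exact: dynhom_eq. Qed.

Lemma dynhom_compA (W X Y Z : dynsys)
    (l : dynhom Y Z) (k : dynhom X Y) (h : dynhom W X) :
  dynhom_comp l (dynhom_comp k h) = dynhom_comp (dynhom_comp l k) h.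
Proof. exact: dynhom_eq. Qed.

Definition K0 : category :=
  Category dynhom_comp1h dynhom_comph1 dynhom_compA.

Definition conjugate (X Y : dynsys) : Prop := @isomorphic K0 X Y.

Definition indecomposable (X : dynsys) : Prop :=
  forall X1 X2 : set X,
    X1 `|` X2 = setT -> X1 `&` X2 = set0 ->
    closed X1 -> closed X2 -> tmap X @` X1 = X1 -> tmap X @` X2 = X2 ->
    X1 = set0 \/ X2 = set0.

(* Only W 0, ..., W m.-1 matter. *)
Definition periodic_partition (X : dynsys) (m : nat) (W : nat -> set X) : Prop :=
  [/\ trivIset `I_m W,
      forall i, (i < m)%N -> clopen (W i),
      \bigcup_(i in `I_m) W i = setT,
      forall i, (0 < i < m)%N -> tmap X @` W i.-1 = W i &
      tmap X @` W m.-1 = W 0].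

Definition partition_lengths (X : dynsys) : set nat :=
  [set m | (0 < m)%N /\ exists W, @periodic_partition X m W].

(* {0, 1, 2, ...} together with infinity, which is None. *)
Definition natinf : Type := option nat.

Definition natinf_le (x y : natinf) : Prop :=
  match x, y with
  | _, None => True
  | None, Some _ => False
  | Some m, Some n => (m <= n)%N
  end.

Definition natinf_lub (A : set nat) : set natinf :=
  [set s | (forall k, A k -> natinf_le (Some k) s) /\
    forall t, (forall k, A k -> natinf_le (Some k) t) -> natinf_le s t].

(* The default value of xget is never used, by natinf_sup_lub. *)
Definition natinf_sup (A : set nat) : natinf := xget None (natinf_lub A).

Lemma natinf_sup_lub (A : set nat) : natinf_lub A (natinf_sup A).
Proof.
rewrite /natinf_sup.
suff : exists s, natinf_lub A s by exact: xgetPex.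
have [ubA|noub] := pselect (exists n, `[<forall k, A k -> (k <= n)%N>]); last first.
  exists None; split => [//|[n|//] ubn]; apply: noub.
  by exists n; apply/asboolP.
exists (Some (ex_minn ubA)); case: ex_minnP => n /asboolP ubn minn.
by split => [//|[m|//] ubm]; apply: minn; apply/asboolP.
Qed.

Definition ultranat : Type := {p : nat | prime p} -> natinf.

Definition ultranat_le (M N : ultranat) : Prop :=
  forall p, natinf_le (M p) (N p).

Definition ultranat0 : ultranat := fun=> Some 0.

Definition Phi (S : set nat) : ultranat := fun p =>
  natinf_sup [set k | exists2 a, S a & (sval p ^ k %| a)%N].

Lemma ultranat_le_refl (N : ultranat) : ultranat_le N N.
Proof. by move=> p; case: (N p) => /=. Qed.

Lemma ultranat_le_trans (L M N : ultranat) :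
  ultranat_le M N -> ultranat_le L M -> ultranat_le L N.
Proof.
move=> MN LM p; move: (LM p) (MN p).
by case: (L p) (M p) (N p) => [l|] [m|] [n|] //=; exact: leq_trans.
Qed.

(* The order on S reversed: one morphism from M to N exactly when N <= M. *)
Definition order_cat (S : set ultranat) : category :=
  @Category {N : ultranat | S N} (fun M N => ultranat_le (sval N) (sval M))
    (fun N => ultranat_le_refl (sval N))
    (fun L M N NM ML => ultranat_le_trans ML NM)
    (fun _ _ _ => Prop_irrelevance _ _) (fun _ _ _ => Prop_irrelevance _ _)
    (fun _ _ _ _ _ _ _ => Prop_irrelevance _ _).

Definition Sigma (X : dynsys) : set ultranat :=
  [set N | ultranat_le N (Phi (partition_lengths X))].

(* Z/nZ for n > 0; unlike 'Z_n, this is the trivial group when n = 1. *)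
Definition cyc (n : nat) : Type := discrete_topology 'I_n.-1.+1.

Definition cyc_add (n : nat) (x y : cyc n) : cyc n :=
  ((x : 'I_n.-1.+1) + (y : 'I_n.-1.+1))%R.

Definition cyc_class (n k : nat) : cyc n := (inZp k : 'I_n.-1.+1).

(* The map from Z/mZ to Z/nZ sending 1 to 1, when n divides m. *)
Definition cyc_red (m n : nat) (x : cyc m) : cyc n :=
  cyc_class n (x : 'I_m.-1.+1).

Record odoseq := OdoSeq {
  oseq :> nat -> nat;
  oseq_gt0 : forall i, (0 < oseq i)%N;
  oseq_dvd : forall i, (oseq i %| oseq i.+1)%N }.

(* The inverse limit, as a subspace of the product. *)
Definition odo_set (n : odoseq) : set (prod_topology (fun i => cyc (n i))) :=
  [set a | forall i, cyc_red (n i) (a i.+1) = a i].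

Arguments odo_set : clear implicits.

Definition odo_space (n : odoseq) : topologicalType := set_type (odo_set n).

Lemma cyc_redD (m n : nat) (x y : cyc m) : (0 < m)%N -> (0 < n)%N ->
  (n %| m)%N ->
  cyc_red n (cyc_add x y) = cyc_add (cyc_red n x) (cyc_red n y).
Proof.
move=> m0 n0 nm; have nm' : (n.-1.+1 %| m.-1.+1)%N by rewrite !prednK.
by apply: val_inj; rewrite /= modn_dvdm // modnDm.
Qed.

Lemma cyc_red_class (m n k : nat) : (0 < m)%N -> (0 < n)%N -> (n %| m)%N ->
  cyc_red n (cyc_class m k) = cyc_class n k.
Proof. by move=> m0 n0 nm; apply: val_inj => /=; rewrite !prednK // modn_dvdm. Qed.

Definition odo_elt (n : odoseq) a (odo_a : odo_set n a) : odo_space n :=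
  exist (fun x => x \in odo_set n) a (mem_set odo_a).

Lemma odo_add_subproof (n : odoseq) (a b : odo_space n) :
  odo_set n (fun i => cyc_add (set_val a i) (set_val b i)).
Proof.
move=> i; rewrite cyc_redD ?oseq_gt0 ?oseq_dvd //.
by rewrite (set_valP a i) (set_valP b i).
Qed.

Definition odo_add (n : odoseq) (a b : odo_space n) : odo_space n :=
  odo_elt (odo_add_subproof a b).

Lemma odo_one_subproof (n : odoseq) : odo_set n (fun i => cyc_class (n i) 1).
Proof. by move=> i; rewrite cyc_red_class ?oseq_gt0 ?oseq_dvd. Qed.

Definition odo_one (n : odoseq) : odo_space n :=
  odo_elt (odo_one_subproof n).

Definition odo_map (n : odoseq) (a : odo_space n) : odo_space n :=
  odo_add a (odo_one n).

Lemma odo_opp_one_subproof (n : odoseq) :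
  odo_set n (fun i => cyc_class (n i) (n i).-1).
Proof.
move=> i; rewrite cyc_red_class ?oseq_gt0 ?oseq_dvd //.
apply: val_inj => /=; rewrite !prednK ?oseq_gt0 //.
apply/eqP; rewrite -(eqn_modDr 1) !addn1 !prednK ?oseq_gt0 // modnn.
by have := oseq_dvd n i; rewrite /dvdn.
Qed.

Definition odo_opp_one (n : odoseq) : odo_space n :=
  odo_elt (odo_opp_one_subproof n).

Lemma odo_addA (n : odoseq) (a b c : odo_space n) :
  odo_add a (odo_add b c) = odo_add (odo_add a b) c.
Proof.
by apply: val_inj; apply: functional_extensionality_dep => i; exact: addrA.
Qed.

Lemma odo_addC (n : odoseq) (a b : odo_space n) : odo_add a b = odo_add b a.
Proof.
by apply: val_inj; apply: functional_extensionality_dep => i; exact: addrC.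
Qed.

Lemma odo_oneK (n : odoseq) (a : odo_space n) :
  odo_add a (odo_add (odo_one n) (odo_opp_one n)) = a.
Proof.
apply: val_inj; apply: functional_extensionality_dep => i.
rewrite /= -[RHS]addr0; congr (_ + _)%R; apply: val_inj => /=.
by rewrite modnDm add1n prednK ?oseq_gt0 // modnn.
Qed.

Lemma odo_proj_continuous (n : odoseq) (i : nat) :
  continuous (fun a : odo_space n => set_val a i).
Proof.
move=> a; apply: (@continuous_comp (odo_space n)
  (prod_topology (fun i => cyc (n i))) (cyc (n i)) set_val (@proj _ _ i)).
  exact: initial_continuous.
exact: proj_continuous.
Qed.

Lemma odo_add_continuous (n : odoseq) (c : odo_space n) :
  continuous (fun a => odo_add a c).
Proof.
apply: (@continuous_comp_initial _ _ _ set_val) => a; apply/cvg_sup.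
  apply: (@fmap_filter _ _ _ (nbhs a)).
move=> i; move: a.
apply: (@continuous_comp_initial _ (odo_space n) (cyc (n i)) (@proj _ (fun i => cyc (n i)) i) (fun a => set_val (odo_add a c))) => a.
apply: (@continuous_comp _ _ _ (fun a : odo_space n => set_val a i)
  (fun x => cyc_add x (set_val c i))); first exact: odo_proj_continuous.
by move=> U /=; rewrite /nbhs/= => nU V ->; apply: nU.
Qed.

Lemma odo_nonempty (n : odoseq) : [set: odo_space n] !=set0.
Proof. by exists (odo_one n). Qed.

Lemma cyc_nbhs (n : nat) (x : cyc n) : nbhs x [set x].
Proof. by move=> _ ->. Qed.

Lemma odo_hausdorff (n : odoseq) : hausdorff_space (odo_space n).
Proof.
move=> a b ab; apply: val_inj; apply: functional_extensionality_dep => i.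
have [c [/= ca cb]] := ab _ _
  (@odo_proj_continuous n i a _ (@cyc_nbhs (n i) _))
  (@odo_proj_continuous n i b _ (@cyc_nbhs (n i) _)).
exact: etrans (esym ca) cb.
Qed.

Lemma odo_closed (n : odoseq) : closed (odo_set n).
Proof.
move=> a cl_a i.
have proj_nbhs j : nbhs a [set b | b j = a j].
  apply: (@proj_continuous nat (fun i => cyc (n i)) j a [set a j]).
  exact: (@cyc_nbhs (n j)).
have [b [odo_b [bS bi]]] :=
  cl_a _ (@filterI _ _ (nbhs_filter a) _ _ (proj_nbhs i.+1) (proj_nbhs i)).
by rewrite /= in bS bi; rewrite -bS -bi; exact: odo_b.
Qed.

Lemma odo_compact (n : odoseq) : compact [set: odo_space n].
Proof.
have odo_cpt : compact (odo_set n).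
  have cpt : compact
      [set a : prod_topology (fun i => cyc (n i)) | forall i, [set: cyc (n i)] (a i)].
    apply: (@tychonoff nat (fun i => cyc (n i)) (fun=> setT)) => i.
    exact/finite_compact/(@finite_finset 'I_(n i).-1.+1).
  exact: subclosed_compact (@odo_closed n) cpt _.
move=> F FF FT.
have [|a [odo_a cl_a]] := odo_cpt (set_val @ F) (fmap_proper_filter _ FF).
  by apply: (@filterS _ F _ setT) FT => a _; exact: set_valP.
exists (odo_elt odo_a); split => // A B FA [_ [[U oU <-] Ua UB]].
have FA' : (set_val @ F) (set_val @` A) by apply: (@filterS _ F _ A) FA => b Ab; exists b.
have [_ [[b Ab <-] Ub]] := cl_a _ U FA' (open_nbhs_nbhs (conj oU Ua)).
by exists b; split => //; exact: UB.
Qed.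

Lemma odo_map_homeo (n : odoseq) : homeomorphism (@odo_map n).
Proof.
split; first exact: odo_add_continuous.
exists (fun a => odo_add a (odo_opp_one n)); split.
- exact: odo_add_continuous.
- by move=> a; rewrite /odo_map -odo_addA odo_oneK.
- by move=> a; rewrite /odo_map -odo_addA (odo_addC (odo_opp_one n)) odo_oneK.
Qed.

Definition odometer (n : odoseq) : dynsys :=
  DynSys (odo_nonempty n) (@odo_compact n) (@odo_hausdorff n) (odo_map_homeo n).

Definition odo_cat : category :=
  @full_subcat K0 (fun Y : dynsys => exists n, conjugate Y (odometer n)).

Definition odo_cat_below (X : dynsys) : category :=
  @full_subcat odo_cat (fun Y =>
    ultranat_le (Phi (partition_lengths (sval Y))) (Phi (partition_lengths X))).

Section FactorCategory.
Variable X : dynsys.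

Definition factor_obj : Type :=
  {Y : Obj (odo_cat_below X) & dynhom X (sval (sval Y))}.

Definition factor_hom (a b : factor_obj) : Type :=
  {p : Hom (projT1 a) (projT1 b) | projT2 b = dynhom_comp p (projT2 a)}.

Definition factor_id (a : factor_obj) : factor_hom a a :=
  exist _ (idm (projT1 a)) (esym (dynhom_comp1h (projT2 a))).

Lemma factor_comp_subproof (a b c : factor_obj)
    (v : factor_hom b c) (u : factor_hom a b) :
  projT2 c = dynhom_comp (compm (sval v) (sval u)) (projT2 a).
Proof.
apply: etrans (svalP v) _.
apply: etrans (congr1 (dynhom_comp (sval v)) (svalP u)) _.
exact: dynhom_compA.
Qed.

Definition factor_comp (a b c : factor_obj)
    (v : factor_hom b c) (u : factor_hom a b) : factor_hom a c :=
  exist _ (compm (sval v) (sval u)) (factor_comp_subproof v u).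

Lemma factor_hom_eq (a b : factor_obj) (u v : factor_hom a b) :
  sval u = sval v -> u = v.
Proof. exact: eq_sig_hprop. Qed.

Lemma factor_comp1m (a b : factor_obj) (u : factor_hom a b) :
  factor_comp (factor_id b) u = u.
Proof. by apply: factor_hom_eq; exact: compm1m. Qed.

Lemma factor_compm1 (a b : factor_obj) (u : factor_hom a b) :
  factor_comp u (factor_id a) = u.
Proof. by apply: factor_hom_eq; exact: compmm1. Qed.

Lemma factor_compA (a b c d : factor_obj)
    (w : factor_hom c d) (v : factor_hom b c) (u : factor_hom a b) :
  factor_comp w (factor_comp v u) = factor_comp (factor_comp w v) u.
Proof. by apply: factor_hom_eq; exact: compmA. Qed.

Definition factor_cat : category :=
  Category factor_comp1m factor_compm1 factor_compA.

End FactorCategory.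

(* Main.v *)
Require Import Defs.
From mathcomp Require Import all_boot.
From mathcomp Require Import all_classical topology.

Set Implicit Arguments.
Unset Strict Implicit.
Unset Printing Implicit Defensive.

Local Open Scope classical_set_scope.

(** A periodic partition of length [n] is the same thing as a continuous map to
    [Z/n] that turns the dynamics into [+1]. Everything is phrased with such
    maps, called phases here and stored as locally constant functions to [nat]
    read modulo [n]. Chinese remaindering of phases shows that the set of
    lengths of [X] consists of all the divisors of the ultranatural number
    [Phi] of this set ([partition_lengths_Phi]), so that comparing two [Phi]
    amounts to comparing two sets of lengths.

    Indecomposability says that locally constant invariant functions are
    constant. Since the difference of two phases is invariant, on an
    indecomposable system a phase modulo [n] is determined by its value at a
    single point ([phase_rigid]). An odometer is the inverse limit of its cyclic
    quotients, hence a morphism into it is a compatible sequence of phases. So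
    if [Z] is indecomposable and [Y] is an odometer whose lengths are lengths of
    [Z], there is exactly one morphism from [Z] to [Y] sending a prescribed
    point to a prescribed point ([odometer_like_hom_ex],
    [odometer_like_hom_eq]): rigidity makes phases normalised at one
    point compatible, and makes any two such morphisms equal.

    Odometers are indecomposable, because orbits are dense. Uniqueness therefore
    shows that the factor category is thin, for every [X]. If moreover [X] is
    indecomposable, existence applied to [Z] an odometer factor of [X] gives a
    morphism between two objects as soon as their [Phi] are comparable, and
    existence applied to [Z = X] realises every [N] below [Phi] of the lengths
    of [X]. So [Phi] is an isomorphism from the skeleton to the ordered set.

    Conversely, the ordered set has an element mapping to all the others,
    namely [Phi] of the lengths of [X]; an isomorphism transports it to an
    object [t] of the skeleton with a morphism to every object of the factor
    category.
    Given an invariant locally constant [b : X -> bool] and a prime length [p]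
    with phase [c], both [c] and [b + c] are factor maps to [Z/p], hence both
    factor through the odometer of [t]. There they differ by a constant, which
    forces [b] to be constant ([weakly_initial_invariants]). *)

(** * Locally constant functions *)

Definition locally_const (T : topologicalType) (U : Type) (c : T -> U) : Prop :=
  forall x, \forall y \near x, c y = c x.

Lemma locally_const_clopen (T : topologicalType) (U : Type) (c : T -> U)
    (D : set U) : locally_const c -> clopen [set x | D (c x)].
Proof.
move=> lc.
have opn E : open [set x | E (c x)].
  by rewrite openE => x Ex; apply: filterS (lc x) => y /= ->.
by split=> //; rewrite -openC; exact: (opn (~` D)).
Qed.

Lemma locally_const_comp (S T : topologicalType) (U : Type) (h : S -> T)
    (c : T -> U) : continuous h -> locally_const c -> locally_const (c \o h).
Proof. by move=> hc lc x; exact: hc (lc (h x)). Qed.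

Lemma locally_const2 (T : topologicalType) (U V W : Type) (g : U -> V -> W)
    (c : T -> U) (d : T -> V) :
  locally_const c -> locally_const d -> locally_const (fun x => g (c x) (d x)).
Proof. by move=> lc ld x; apply: filterS2 (lc x) (ld x) => y -> ->. Qed.

(** * Phases and periodic partitions *)

Definition phase (X : dynsys) (n : nat) (c : X -> nat) : Prop :=
  locally_const c /\ forall x, c (tmap X x) = (c x).+1 %[mod n].

Lemma dynhom_equivariant (X Y : dynsys) (h : dynhom X Y) x :
  sval h (tmap X x) = tmap Y (sval h x).
Proof. by have /(congr1 (fun k => k x)) := (svalP h).2. Qed.

Lemma phase_comp (X Y : dynsys) (h : dynhom X Y) n (c : Y -> nat) :
  phase n c -> phase n (c \o sval h).
Proof.
move=> [lc ec]; split; first exact: locally_const_comp (svalP h).1 lc.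
by move=> x /=; rewrite dynhom_equivariant.
Qed.

Lemma phase_dvd (X : dynsys) m n (c : X -> nat) :
  (m %| n)%N -> phase n c -> phase m c.
Proof.
by move=> mn [lc ec]; split=> // x; rewrite -[LHS](modn_dvdm _ mn) ec modn_dvdm.
Qed.

Lemma phase_addl (X : dynsys) n (c e : X -> nat) :
  phase n c -> locally_const e -> (forall x, e (tmap X x) = e x) ->
  phase n (fun x => e x + c x)%N.
Proof.
move=> [lc ec] le ee; split; first exact: (locally_const2 addn le lc).
by move=> x; rewrite ee -modnDmr ec modnDmr addnS.
Qed.

(** Chinese remaindering identifies [Z/m x Z/n] with [Z/mn] compatibly with
    [+1], so two phases of coprime moduli combine into one. *)
Lemma phase_coprime (X : dynsys) m n (c d : X -> nat) : coprime m n ->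
  phase m c -> phase n d -> phase (m * n) (fun x => chinese m n (c x) (d x)).
Proof.
move=> mn [lc ec] [ld ed]; split.
  exact: (locally_const2 (chinese m n) lc ld).
move=> x; apply/eqP; rewrite chinese_remainder //; apply/andP; split.
  rewrite chinese_modl // ec -addn1 -[in X in _ == X]addn1 eqn_modDr.
  by rewrite chinese_modl.
rewrite chinese_modr // ed -addn1 -[in X in _ == X]addn1 eqn_modDr.
by rewrite chinese_modr.
Qed.

Lemma phase_iter (X : dynsys) n (c : X -> nat) k x :
  phase n c -> c (iter k (tmap X) x) = c x + k %[mod n].
Proof.
move=> [_ ec]; elim: k => [|k IH]; first by rewrite addn0.
by rewrite iterS ec -addn1 -modnDml IH modnDml addn1 addnS.
Qed.

Lemma tmap_surj (X : dynsys) (y : X) : exists x, tmap X x = y.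
Proof. by have [_ [g [_ _ gK]]] := tmap_homeo X; exists (g y). Qed.

(** The blocks of a partition are the fibres of a phase. Surjectivity of the
    dynamics is what makes it map each fibre onto the next one. *)
Lemma partition_lengthsP (X : dynsys) n :
  partition_lengths X n <-> (0 < n)%N /\ exists c : X -> nat, phase n c.
Proof.
split=> -[n0 [c]].
  case=> triv opn cov next last; split=> //.
  have /choice[i ci] : forall x, exists i, (i < n)%N /\ c i x.
    by move=> x; have : [set: X] x by []; rewrite -cov => -[i]; exists i.
  have ciE x j : (j < n)%N -> c j x -> i x = j.
    move=> jn cjx; have [ixn cix] := ci x.
    by apply: triv => //; exists x.
  exists i; split=> x.
    have [ixn cix] := ci x; have [op _] := opn _ ixn.
    by apply: filterS (open_nbhs_nbhs (conj op cix)) => y; exact: ciE.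
  have [ixn cix] := ci x.
  have [lt|] := ltnP (i x).+1 n.
    by rewrite (ciE _ (i x).+1) // -next //; exists x.
  move=> ge; have ixE : (i x).+1 = n by apply/eqP; rewrite eqn_leq ixn ge.
  rewrite ixE modnn (ciE _ 0%N) ?mod0n // -last; exists x => //.
  by rewrite -ixE.
case=> lc ec; split=> //; exists (fun i => [set x | c x %% n = i]).
have img i j : (i.+1 = j %[mod n]) -> (i < n)%N -> (j < n)%N ->
    tmap X @` [set x | c x %% n = i] = [set x | c x %% n = j].
  move=> ij ln jn; apply/seteqP; split=> [_ [x /= cx <-]|y /= cy].
    by rewrite ec -addn1 -modnDml cx addn1 ij modn_small.
  have [x xy] := tmap_surj y; exists x => //=.
  move: cy; rewrite -xy ec -[RHS](modn_small jn) -ij => cy.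
  rewrite -[RHS](modn_small ln); apply/eqP.
  by rewrite -(eqn_modDr 1) !addn1 cy.
split.
- by move=> i j _ _ [x [/= <- <-]].
- by move=> i _; exact: (locally_const_clopen (fun k => k %% n = i)).
- by apply/seteqP; split=> // x _; exists (c x %% n) => //=; rewrite ltn_mod.
- move=> i /andP[i0 ni]; apply: img => //; by rewrite prednK // ltnW.
- by apply: img => //; rewrite prednK // modnn mod0n.
Qed.

Lemma partition_lengths1 (X : dynsys) : partition_lengths X 1.
Proof.
apply/partition_lengthsP; split=> //; exists (fun=> 0%N); split=> [x|x].
  exact: filterE.
by rewrite !modn1.
Qed.

Lemma partition_lengths_dvd (X : dynsys) m n :
  (m %| n)%N -> partition_lengths X n -> partition_lengths X m.
Proof.
move=> mn /partition_lengthsP[n0 [c pc]]; apply/partition_lengthsP.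
by split; [exact: dvdn_gt0 mn|exists c; exact: phase_dvd pc].
Qed.

Lemma partition_lengths_coprime (X : dynsys) m n : coprime m n ->
  partition_lengths X m -> partition_lengths X n -> partition_lengths X (m * n).
Proof.
move=> mn /partition_lengthsP[m0 [c pc]] /partition_lengthsP[n0 [d pd]].
apply/partition_lengthsP; split; first by rewrite muln_gt0 m0.
by exists (fun x => chinese m n (c x) (d x)); exact: phase_coprime.
Qed.

Lemma partition_lengths_hom (X Y : dynsys) (h : dynhom X Y) :
  partition_lengths Y `<=` partition_lengths X.
Proof.
move=> n /partition_lengthsP[n0 [c pc]]; apply/partition_lengthsP; split=> //.
by exists (c \o sval h); exact: phase_comp.
Qed.

(** * Ultranatural numbers *)

Lemma natinf_le_trans x y z : natinf_le x y -> natinf_le y z -> natinf_le x z.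
Proof. by case: x y z => [x|] [y|] [z|] //=; exact: leq_trans. Qed.

(** Infinity never has to be mentioned: an element is determined by the finite
    elements below it. *)
Lemma natinf_leP x y :
  (forall k, natinf_le (Some k) x -> natinf_le (Some k) y) -> natinf_le x y.
Proof.
case: x y => [x|] [y|] //= le; first exact: (le x).
by have := le y.+1 I; rewrite ltnn.
Qed.

Lemma natinf_le_sup (A : set nat) k : A 0 ->
  natinf_le (Some k) (natinf_sup A) <-> exists2 j, A j & (k <= j)%N.
Proof.
move=> A0; have [ub least] := natinf_sup_lub A; split; last first.
  by move=> [j Aj kj]; apply: natinf_le_trans (ub j Aj).
case: k => [_|k le]; first by exists 0.
apply: contrapT => no; suff : natinf_le (Some k.+1) (Some k) by rewrite /= ltnn.
apply: natinf_le_trans le (least _ _) => j Aj /=.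
by rewrite leqNgt; apply/negP => kj; apply: no; exists j.
Qed.

Lemma natinf_le_antisym x y : natinf_le x y -> natinf_le y x -> x = y.
Proof.
by case: x y => [x|] [y|] //= xy yx; congr Some; apply/eqP; rewrite eqn_leq xy.
Qed.

Lemma ultranat_le_antisym M N : ultranat_le M N -> ultranat_le N M -> M = N.
Proof. by move=> MN NM; apply: funext => p; exact: natinf_le_antisym. Qed.

Lemma le_Phi (S : set nat) p k : S 1 ->
  natinf_le (Some k) (Phi S p) <-> exists2 a, S a & (sval p ^ k %| a)%N.
Proof.
move=> S1; rewrite natinf_le_sup; last by exists 1.
split=> [[j [a Sa ja] kj]|[a Sa ka]]; last by exists k => //; exists a.
by exists a => //; apply: dvdn_trans ja; exact: dvdn_exp2l.
Qed.

Definition ultradvd (N : ultranat) (d : nat) : Prop :=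
  (0 < d)%N /\ forall p, natinf_le (Some (logn (sval p) d)) (N p).

Lemma ultradvd1 N : ultradvd N 1.
Proof. by split=> // p; rewrite logn1; case: (N p). Qed.

Lemma ultradvd_le M N d : ultranat_le M N -> ultradvd M d -> ultradvd N d.
Proof. by move=> MN [d0 Md]; split=> // p; apply: natinf_le_trans (MN p). Qed.

Lemma ultradvd_dvd N d e : (e %| d)%N -> ultradvd N d -> ultradvd N e.
Proof.
move=> ed [d0 Nd]; split; first exact: dvdn_gt0 ed.
by move=> p; apply: natinf_le_trans (Nd p); exact: dvdn_leq_log.
Qed.

Lemma ultradvd_lcm N d e :
  ultradvd N d -> ultradvd N e -> ultradvd N (lcmn d e).
Proof.
move=> [d0 Nd] [e0 Ne]; split; first by rewrite lcmn_gt0 d0.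
by move=> p; rewrite logn_lcm // /maxn; case: ifP.
Qed.

Lemma ultradvd_pfactor N p k :
  ultradvd N (sval p ^ k) <-> natinf_le (Some k) (N p).
Proof.
case: p => p pp /=; split=> [[_ /(_ (exist _ p pp))]|le].
  by rewrite /= pfactorK.
split; first by rewrite expn_gt0 prime_gt0.
move=> [q qq] /=; rewrite lognX logn_prime //; case: eqP => [e|_].
  by subst q; rewrite muln1 (bool_irrelevance qq pp).
by rewrite muln0; case: (N _).
Qed.

Lemma Phi_le (S : set nat) N :
  S 1 -> S `<=` ultradvd N -> ultranat_le (Phi S) N.
Proof.
move=> S1 SN p; apply: natinf_leP => k /(le_Phi _ _ S1)[a Sa ka].
by apply/ultradvd_pfactor; apply: ultradvd_dvd ka _; exact: SN.
Qed.

(** Closure of the set of lengths under divisors makes every prime power that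
    divides [Phi] a length; closure under coprime products then reassembles an
    arbitrary divisor from its prime powers. *)
Lemma partition_lengths_Phi (X : dynsys) :
  partition_lengths X = ultradvd (Phi (partition_lengths X)).
Proof.
set S := partition_lengths X.
have S1 : S 1 := partition_lengths1 X.
have SX p k : prime p -> ultradvd (Phi S) (p ^ k) -> S (p ^ k).
  move=> pp /(@ultradvd_pfactor _ (exist _ p pp)) /(le_Phi _ _ S1)[a Sa].
  by move=> /partition_lengths_dvd; apply.
apply/seteqP; split=> n.
  move=> Sn; split; first by have [] := Sn.
  by move=> p; apply/(le_Phi _ _ S1); exists n => //; exact: pfactor_dvdnn.
have [m] := ubnP n; elim: m n => // m IH n; rewrite ltnS => nm Sn.
have [n0 _] := Sn; have [n1|n1] := leqP n 1.
  by have -> : n = 1 by apply/eqP; rewrite eqn_leq n1.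
have pp := pdiv_prime n1; rewrite -(partnC (pdiv n) n0).
apply: partition_lengths_coprime; first exact: coprime_partC.
  rewrite p_part; apply: SX => //; rewrite -p_part.
  by apply: ultradvd_dvd Sn; exact: dvdn_part.
apply: IH; last by apply: ultradvd_dvd Sn; exact: dvdn_part.
apply: leq_trans nm; rewrite -[X in (_ < X)%N](partnC (pdiv n) n0) ltn_Pmull //.
rewrite p_part -[X in (X < _)%N](expn0 (pdiv n)) ltn_exp2l ?prime_gt1 //.
by rewrite logn_gt0 mem_primes pp n0 pdiv_dvd.
Qed.

(** * Odometers *)

Definition odo_coord (n : odoseq) (i : nat) (a : odo_space n) : nat :=
  (set_val a i : 'I_(n i).-1.+1).

Section Odometers.
Variable n : odoseq.
Implicit Types a b : odo_space n.

Lemma odo_coord_lt i a : (odo_coord i a < n i)%N.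
Proof. by rewrite -[X in (_ < X)%N](prednK (oseq_gt0 n i)); exact: ltn_ord. Qed.

Lemma odo_coord_inj a b : (forall i, odo_coord i a = odo_coord i b) -> a = b.
Proof.
move=> ab; apply: val_inj; apply: functional_extensionality_dep => i.
by apply: val_inj; exact: ab.
Qed.

Lemma odo_coordS i a : odo_coord i.+1 a = odo_coord i a %[mod n i].
Proof.
have e : odo_coord i.+1 a %% (n i).-1.+1 = odo_coord i a.
  have aE : cyc_red (n i) (set_val a i.+1) = set_val a i := set_valP a i.
  by rewrite /odo_coord -[in RHS]aE.
by rewrite [RHS]modn_small ?odo_coord_lt // -e prednK ?oseq_gt0.
Qed.

Lemma oseq_dvdn i j : (i <= j)%N -> (n i %| n j)%N.
Proof.
elim: j => [|j IH]; first by rewrite leqn0 => /eqP ->.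
rewrite leq_eqVlt => /predU1P[->//|]; rewrite ltnS => /IH /dvdn_trans.
by apply; exact: oseq_dvd.
Qed.

Lemma odo_coord_mod j i a :
  (i <= j)%N -> odo_coord j a = odo_coord i a %[mod n i].
Proof.
elim: j => [|j IH]; first by rewrite leqn0 => /eqP ->.
rewrite leq_eqVlt => /predU1P[->//|]; rewrite ltnS => ij.
by rewrite -IH // -(modn_dvdm _ (oseq_dvdn ij)) odo_coordS modn_dvdm ?oseq_dvdn.
Qed.

Lemma odo_coord_phase i : phase (n i) (@odo_coord n i : odometer n -> nat).
Proof.
split=> [a|a].
  have near_a : nbhs a [set b : odo_space n | set_val b i = set_val a i].
    exact: @odo_proj_continuous n i a [set set_val a i] (@cyc_nbhs (n i) _).
  apply: filterS near_a => b /= ba.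
  by rewrite /odo_coord ba.
have -> : odo_coord i (tmap (odometer n) a) =
  (odo_coord i a + 1 %% (n i).-1.+1) %% (n i).-1.+1 by [].
by rewrite prednK ?oseq_gt0 // modn_mod modnDmr addn1.
Qed.

Lemma odo_continuous (T : topologicalType) (h : T -> odo_space n) :
  (forall i, locally_const (fun x => odo_coord i (h x))) -> continuous h.
Proof.
move=> lh; apply: (@continuous_comp_initial _ _ _ set_val) => x; apply/cvg_sup.
move=> i; move: x.
apply: (@continuous_comp_initial _ _ (cyc (n i))
  (@proj _ (fun i => cyc (n i)) i) (fun x => set_val (h x))) => x U Ux.
apply: filterS (lh i x) => y /= e.
have -> : proj i (set_val (h y)) = proj i (set_val (h x)).
  by apply: val_inj; exact: e.
exact: Ux.
Qed.

(** The cylinders given by one coordinate form a basis of neighbourhoods. They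
    decrease, and by compactness the filter that they generate converges, [a]
    being the only point in all of them. *)
Lemma odo_cylinder a (U : set (odo_space n)) : nbhs a U ->
  exists i, forall b, odo_coord i b = odo_coord i a -> U b.
Proof.
pose C i := [set b : odo_space n | odo_coord i b = odo_coord i a].
have CS i j : (i <= j)%N -> C j `<=` C i.
  move=> ij b bj; rewrite /C /= in bj *.
  rewrite -(modn_small (odo_coord_lt i b)).
  by rewrite -(odo_coord_mod b ij) bj odo_coord_mod // modn_small ?odo_coord_lt.
pose F := filter_from setT C.
have FF : ProperFilter F.
  apply: filter_from_proper; last by move=> i _; exists a.
  apply: filter_from_filter; first by exists 0.
  move=> i j _ _; exists (maxn i j) => // b Cb.
  by split; apply: CS Cb; rewrite ?leq_maxl ?leq_maxr.
suff clF : cluster F = [set a].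
  move=> aU; have [i _ CU] := compact_cluster_set1 (@odo_hausdorff n)
    (@odo_compact n) filterT FF filterT clF aU.
  by exists i.
apply/seteqP; split=> [b Fb|_ ->].
  apply: odo_coord_inj => i.
  have FC : F (C i) by exists i.
  by have [c [/= <- <-]] := Fb _ _ FC ((odo_coord_phase i).1 b).
by move=> A B [i _ CA] /nbhs_singleton aB; exists a; split=> //; exact: CA.
Qed.

(** The universal property of the inverse limit, read on phases. *)
Lemma odo_lift (Y : dynsys) (c : nat -> Y -> nat) :
  (forall i, phase (n i) (c i)) ->
  (forall i y, c i.+1 y = c i y %[mod n i]) ->
  exists h : dynhom Y (odometer n),
    forall y i, odo_coord i (sval h y) = c i y %% n i.
Proof.
move=> pc cS.
have odo_c y : odo_set n (fun i => cyc_class (n i) (c i y)).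
  move=> i; rewrite cyc_red_class ?oseq_gt0 ?oseq_dvd //; apply: val_inj.
  by rewrite /= prednK ?oseq_gt0.
pose h y : odometer n := odo_elt (odo_c y).
have hE y i : odo_coord i (h y) = c i y %% n i.
  by rewrite /odo_coord /= prednK ?oseq_gt0.
have hc : continuous h.
  apply: odo_continuous => i y; apply: filterS ((pc i).1 y) => z cz.
  by rewrite !hE cz.
have he : h \o tmap Y = tmap (odometer n) \o h.
  apply: funext => y; apply: odo_coord_inj => i.
  rewrite -[RHS](modn_small (odo_coord_lt _ _)) (odo_coord_phase i).2 /=.
  rewrite !hE (pc i).2.
  by rewrite -[in RHS]addn1 modnDml addn1.
by exists (exist _ h (conj hc he)).
Qed.

End Odometers.

(** * Indecomposable systems and rigidity *)

(** The working form of indecomposability: it passes to conjugate systems by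
    mere composition. *)
Definition invariants_const (X : dynsys) : Prop :=
  forall b : X -> bool, locally_const b -> (forall x, b (tmap X x) = b x) ->
  forall x y, b x = b y.

Lemma indecomposableP (X : dynsys) : indecomposable X <-> invariants_const X.
Proof.
split=> [indX b lb eb x y|invX X1 X2 U I cX1 cX2 f1 f2].
  have img (v : bool) : tmap X @` [set x | b x = v] = [set x | b x = v].
    apply/seteqP; split=> [_ [z /= bz <-]|z /= bz]; first by rewrite eb.
    by have [w wz] := tmap_surj z; exists w => //=; rewrite -eb wz.
  have cl v : closed [set x | b x = v] := (locally_const_clopen [set v] lb).2.
  have [||e|e] := indX [set x | b x = true] [set x | b x = false]
    _ _ (cl _) (cl _) (img _) (img _).
  - by apply/seteqP; split=> // z _ /=; case: (b z); [left|right].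
  - by apply/seteqP; split=> // z [/= ->].
  - have n z : b z = false.
      by apply/negP => bz; have : set0 z by rewrite -e.
    by rewrite !n.
  - have n z : b z = true.
      by apply/negPn/negP => /negbTE bz; have : set0 z by rewrite -e.
    by rewrite !n.
have X2E : X2 = ~` X1.
  apply/seteqP; split=> z; first by move=> X2z X1z; have : set0 z by rewrite -I.
  by move=> nz; have [] : (X1 `|` X2) z by rewrite U.
have lb : locally_const (fun x => `[<X1 x>]).
  move=> x; have [X1x|X1x] := pselect (X1 x).
    have oX1 : open X1 by rewrite -closedC -X2E.
    apply: filterS (open_nbhs_nbhs (conj oX1 X1x)) => y X1y.
    by rewrite !asboolT.
  have oX2 : open (~` X1) by rewrite openC.
  by apply: filterS (open_nbhs_nbhs (conj oX2 X1x)) => y X1y; rewrite !asboolF.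
have eb x : `[<X1 (tmap X x)>] = `[<X1 x>].
  have [X1x|X1x] := pselect (X1 x); first by rewrite !asboolT // -f1; exists x.
  rewrite !asboolF //; suff : X2 (tmap X x) by rewrite X2E.
  by rewrite -f2; exists x => //; rewrite X2E.
have [x _] := space_nonempty X.
have [X1x|X1x] := pselect (X1 x); [right|left].
  apply/seteqP; split=> // y; rewrite X2E; apply.
  by apply/asboolP; rewrite (invX _ lb eb y x); apply/asboolP.
apply/seteqP; split=> // y X1y; apply: X1x.
by apply/asboolP; rewrite (invX _ lb eb x y); apply/asboolP.
Qed.

(** Where two phases agree is an invariant clopen set. *)
Lemma phase_rigid (X : dynsys) n (c d : X -> nat) x y : invariants_const X ->
  phase n c -> phase n d -> c x = d x %[mod n] -> c y = d y %[mod n].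
Proof.
move=> invX [lc ec] [ld ed] /eqP cdx; apply/eqP; move: cdx.
rewrite (invX (fun z => c z == d z %[mod n]) _ _ x y) //.
  exact: (locally_const2 (fun u v => u == v %[mod n]) lc ld).
by move=> z; rewrite ec ed -addn1 -[in X in _ == X]addn1 eqn_modDr.
Qed.

Arguments phase_rigid [X n c d] x y.

(** The orbit of [x] meets the cylinder around [y] on which [b] equals [b y]. *)
Lemma odometer_invariants (n : odoseq) : invariants_const (odometer n).
Proof.
move=> b lb eb x y; have [i Ci] := odo_cylinder (lb y).
have it k : b (iter k (tmap (odometer n)) x) = b x.
  by elim: k => // k <-; exact: eb.
(* This many steps bring the [i]-th coordinate of [x] to that of [y]. *)
rewrite -(it (odo_coord i y + (n i - odo_coord i x))%N); apply: Ci.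
rewrite -(modn_small (odo_coord_lt i (iter _ _ _))).
rewrite (phase_iter _ _ (odo_coord_phase n i)) addnCA subnKC; last first.
  by rewrite ltnW // odo_coord_lt.
by rewrite modnDr modn_small // odo_coord_lt.
Qed.

(** A phase modulo [d] is constant on a cylinder of some level [i], to which
    every point returns after [n i] steps; so [d] divides [n i]. *)
Lemma odometer_lengths (n : odoseq) d :
  partition_lengths (odometer n) d <-> exists i, (d %| n i)%N.
Proof.
split=> [/partition_lengthsP[d0 [c pc]]|[i di]]; last first.
  apply: partition_lengths_dvd di _; apply/partition_lengthsP.
  by split; [exact: oseq_gt0|exists (@odo_coord n i); exact: odo_coord_phase].
have [i Ci] := odo_cylinder (pc.1 (odo_one n)); exists i.
have /Ci ce : odo_coord i (iter (n i) (tmap (odometer n)) (odo_one n)) =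
    odo_coord i (odo_one n).
  rewrite -(modn_small (odo_coord_lt i (iter _ _ _))).
  rewrite (phase_iter _ _ (odo_coord_phase n i)) modnDr.
  by rewrite modn_small // odo_coord_lt.
have /eqP := phase_iter (n i) (odo_one n : odometer n) pc.
by rewrite ce -[X in X == _ %[mod _]]addn0 eqn_modDl mod0n eq_sym.
Qed.

Definition odometer_like (Y : dynsys) : Prop :=
  exists n, conjugate Y (odometer n).

Lemma odometer_like_invariants Y : odometer_like Y -> invariants_const Y.
Proof.
move=> [n [u [v [vu uv]]]] b lb eb x y.
have vuK z : sval v (sval u z) = z :=
  congr1 (fun w : dynhom Y Y => sval w z) vu.
rewrite -(vuK x) -(vuK y).
apply: (@odometer_invariants n (b \o sval v)).
  exact: locally_const_comp (svalP v).1 lb.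
by move=> z; rewrite -[RHS](eb (sval v z)) -dynhom_equivariant.
Qed.

(** * Morphisms from an indecomposable system to an odometer *)

(** Phases modulo the [n i], chosen independently, need not be compatible.
    Translating each of them to take the value prescribed by [a0] at [z0] makes
    them compatible at [z0], hence everywhere by rigidity. *)
Lemma dynhom_odometer_ex (Z : dynsys) (n : odoseq) (z0 : Z) (a0 : odometer n) :
  invariants_const Z -> (forall i, partition_lengths Z (n i)) ->
  exists h : dynhom Z (odometer n), sval h z0 = a0.
Proof.
move=> invZ PZ.
have /choice[c pc] : forall i, exists c : Z -> nat, phase (n i) c.
  by move=> i; have /partition_lengthsP[] := PZ i.
(* Modulo [n i], the multiple of [c i z0] subtracts [c i z0]. *)
pose d i z := ((odo_coord i a0 + (n i).-1 * c i z0) + c i z)%N.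
have pd i : phase (n i) (d i).
  by apply: (@phase_addl _ _ _ (fun=> _)) => // x; exact: filterE.
have dz0 i : d i z0 = odo_coord i a0 %[mod n i].
  by rewrite /d -addnA -mulSnr prednK ?oseq_gt0 // addnC mulnC modnMDl.
have [i z|h hE] := odo_lift pd.
  apply: (phase_rigid z0 z invZ _ (pd i)).
    exact: phase_dvd (oseq_dvd n i) (pd i.+1).
  rewrite dz0 -odo_coordS -(modn_dvdm _ (oseq_dvd n i)) dz0.
  by rewrite modn_dvdm // oseq_dvd.
exists h; apply: odo_coord_inj => i.
by rewrite hE dz0 modn_small // odo_coord_lt.
Qed.

Lemma odometer_like_hom_ex (Z Y : dynsys) (z0 : Z) (y0 : Y) :
  invariants_const Z -> odometer_like Y ->
  partition_lengths Y `<=` partition_lengths Z ->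
  exists h : dynhom Z Y, sval h z0 = y0.
Proof.
move=> invZ [n [u [v [vu uv]]]] PYZ.
have [i|k kz0] := @dynhom_odometer_ex Z n z0 (sval u y0) invZ.
  by apply/PYZ/(partition_lengths_hom u)/odometer_lengths; exists i.
exists (dynhom_comp v k); rewrite /= kz0.
exact (congr1 (fun w : dynhom Y Y => sval w y0) vu).
Qed.

Lemma odometer_like_hom_eq (Z Y : dynsys) (h k : dynhom Z Y) (z0 : Z) :
  invariants_const Z -> odometer_like Y -> sval h z0 = sval k z0 -> h = k.
Proof.
move=> invZ [n [u [v [vu _]]]] hk; apply: dynhom_eq; apply: funext => z.
have vuK y : sval v (sval u y) = y :=
  congr1 (fun w : dynhom Y Y => sval w y) vu.
rewrite -(vuK (sval h z)) -(vuK (sval k z)); congr (sval v _).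
apply: odo_coord_inj => i.
have pu (l : dynhom Z Y) :
    phase (n i) (@odo_coord n i \o sval (dynhom_comp u l)).
  exact: phase_comp (odo_coord_phase n i).
have := phase_rigid z0 z invZ (pu h) (pu k).
by rewrite /= hk !modn_small ?odo_coord_lt //; apply.
Qed.

(** * The odometer of an ultranatural number *)

(** The least common multiple of the divisors of [N] up to [i]: as [i] grows,
    these are divisors of [N], each dividing the next, and every divisor of [N]
    divides one of them. *)
Definition divisor_lcm (N : ultranat) (i : nat) : nat :=
  \big[lcmn/1%N]_(0 <= d < i.+1 | `[<ultradvd N d>]) d.

Lemma divisor_lcmS N i : divisor_lcm N i.+1 =
  lcmn (divisor_lcm N i) (if `[<ultradvd N i.+1>] then i.+1 else 1).
Proof. by rewrite /divisor_lcm big_mkcond big_nat_recr //= -big_mkcond. Qed.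

Lemma ultradvd_divisor_lcm N i : ultradvd N (divisor_lcm N i).
Proof.
apply: (big_ind (ultradvd N)); [exact: ultradvd1|exact: ultradvd_lcm|].
by move=> d /asboolP.
Qed.

Lemma divisor_lcm_dvd N i : (divisor_lcm N i %| divisor_lcm N i.+1)%N.
Proof. by rewrite divisor_lcmS dvdn_lcml. Qed.

Lemma dvdn_divisor_lcm N d : ultradvd N d -> (d %| divisor_lcm N d)%N.
Proof.
case: d => [[]//|d] Nd; rewrite divisor_lcmS asboolT //; exact: dvdn_lcmr.
Qed.

Definition ultranat_odoseq (N : ultranat) : odoseq :=
  OdoSeq (fun i => (ultradvd_divisor_lcm N i).1) (divisor_lcm_dvd N).

Lemma Phi_ultranat_odometer N :
  Phi (partition_lengths (odometer (ultranat_odoseq N))) = N.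
Proof.
have S1 := partition_lengths1 (odometer (ultranat_odoseq N)).
apply: ultranat_le_antisym.
  apply: Phi_le => // d /odometer_lengths[i di].
  exact: ultradvd_dvd di (ultradvd_divisor_lcm N i).
move=> p; apply: natinf_leP => k /ultradvd_pfactor Nk; apply/(le_Phi _ _ S1).
exists (sval p ^ k)%N => //; apply/odometer_lengths.
by exists (sval p ^ k)%N; exact: dvdn_divisor_lcm.
Qed.

(** * Isomorphisms of thin categories *)

Lemma inj_surj_bij (A B : Type) (f : A -> B) :
  injective f -> (forall y, exists x, f x = y) -> bijective f.
Proof. by move=> fI /choice[g gK]; exists g => // x; apply: fI; rewrite gK. Qed.

(** In a thin category an arrow is determined by its end points, which a functor
    bijective on objects does not confuse. *)
Lemma thin_isomorphic_categories (C D : category) (F : functor C D) :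
  (forall a b (u v : @Hom C a b), u = v) ->
  (forall a b (u v : @Hom D a b), u = v) ->
  bijective (fobj F) ->
  (forall a b, @Hom D (fobj F a) (fobj F b) -> inhabited (@Hom C a b)) ->
  isomorphic_categories C D.
Proof.
move=> thC thD bijF fullF; exists F; split=> //; apply: inj_surj_bij.
  move=> [a [b u]] [a' [b' u']] e.
  have /(bij_inj bijF) ea : fobj F a = fobj F a' :=
    congr1 (fun t => projT1 t) e.
  have /(bij_inj bijF) eb : fobj F b = fobj F b' :=
    congr1 (fun t : arrows D => projT1 (projT2 t)) e.
  by subst a' b'; rewrite (thC _ _ u u').
have [G FK GK] := bijF; move=> [x [y]]; rewrite -(GK x) -(GK y) => w.
have [u] := fullF _ _ w; exists (existT _ (G x) (existT _ (G y) u)).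
by rewrite /farrows /= (thD _ _ w (fhom F u)).
Qed.

Lemma isomorphism_full (C D : category) (F : functor C D) :
  bijective (fobj F) -> bijective (farrows F) ->
  forall a b, @Hom D (fobj F a) (fobj F b) -> inhabited (@Hom C a b).
Proof.
move=> bijF [G _ GK] a b w.
have := GK (existT _ (fobj F a) (existT _ (fobj F b) w)).
case: (G _) => a' [b' u] e.
have /(bij_inj bijF) ea : fobj F a' = fobj F a := congr1 (fun t => projT1 t) e.
have /(bij_inj bijF) eb : fobj F b' = fobj F b :=
  congr1 (fun t : arrows D => projT1 (projT2 t)) e.
by subst a' b'.
Qed.

(** * The factor category *)

Section FactorCategoryOf.
Variable X : dynsys.

Definition target (o : factor_obj X) : dynsys := sval (sval (projT1 o)).

Definition leg (o : factor_obj X) : dynhom X (target o) := projT2 o.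

Lemma target_odometer_like o : odometer_like (target o).
Proof. exact: (svalP (sval (projT1 o))). Qed.

Lemma Phi_target_le o :
  ultranat_le (Phi (partition_lengths (target o))) (Phi (partition_lengths X)).
Proof. exact: (svalP (projT1 o)). Qed.

Lemma Phi_hom (Y Z : dynsys) (h : dynhom Y Z) :
  ultranat_le (Phi (partition_lengths Z)) (Phi (partition_lengths Y)).
Proof.
apply: Phi_le; first exact: partition_lengths1.
by rewrite -partition_lengths_Phi; exact: partition_lengths_hom.
Qed.

Lemma odometer_self_like n : odometer_like (odometer n).
Proof. by exists n, (dynhom_id _), (dynhom_id _); split; exact: dynhom_eq. Qed.

Definition odometer_factor n (h : dynhom X (odometer n)) : factor_obj X :=
  existT (fun Y : Obj (odo_cat_below X) => dynhom X (sval (sval Y)))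
    (exist _ (exist _ (odometer n) (odometer_self_like n)) (Phi_hom h)) h.

Lemma factor_hom_leg (a b : factor_obj X) (u : factor_hom a b) :
  exists k : dynhom (target a) (target b), leg b = dynhom_comp k (leg a).
Proof. by exists (sval u); exact: (svalP u). Qed.

(** Two morphisms from [a] to [b] agree at a point of the image of [X], and the
    odometer [target a] is indecomposable; nothing is asked of [X]. *)
Lemma factor_hom_unique (a b : factor_obj X) (u v : factor_hom a b) : u = v.
Proof.
have [x0 _] := space_nonempty X; apply: factor_hom_eq.
apply: (@odometer_like_hom_eq (target a) (target b) _ _ (sval (leg a) x0)).
- exact/odometer_like_invariants/target_odometer_like.
- exact: target_odometer_like.
have := etrans (esym (svalP u)) (svalP v).
by move=> /(congr1 (fun k : dynhom X (target b) => sval k x0)).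
Qed.

(** Choose the morphism of odometers that is right at the image of one point
    [x0] of [X]; the triangle then commutes at [x0], hence everywhere by
    rigidity on [X]. *)
Lemma factor_hom_ex (a b : factor_obj X) : invariants_const X ->
  ultranat_le (Phi (partition_lengths (target b)))
              (Phi (partition_lengths (target a))) ->
  inhabited (factor_hom a b).
Proof.
move=> invX le; have [x0 _] := space_nonempty X.
have [||k kE] := @odometer_like_hom_ex (target a) (target b)
  (sval (leg a) x0) (sval (leg b) x0) _ (target_odometer_like b).
- exact/odometer_like_invariants/target_odometer_like.
- move=> d; rewrite (partition_lengths_Phi (target b)) => /(ultradvd_le le).
  by rewrite -partition_lengths_Phi.
constructor; exists k; apply: (odometer_like_hom_eq (z0 := x0)) => //.
exact: target_odometer_like.
Qed.

Lemma factor_obj_ex N : invariants_const X -> Sigma X N ->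
  exists o : factor_obj X, Phi (partition_lengths (target o)) = N.
Proof.
move=> invX XN; have [x0 _] := space_nonempty X.
have [i|h _] := @dynhom_odometer_ex X (ultranat_odoseq N) x0 (odo_one _) invX.
  rewrite partition_lengths_Phi; apply: ultradvd_le XN _.
  exact: ultradvd_divisor_lcm.
by exists (odometer_factor h); exact: Phi_ultranat_odometer.
Qed.

(** An object mapping to all others must see the phases [c] and [b + c] at the
    same time, and on its odometer these can only differ by a constant. *)
Lemma weakly_initial_invariants (t : factor_obj X) :
  Phi (partition_lengths X) <> ultranat0 ->
  (forall o, inhabited (factor_hom t o)) -> invariants_const X.
Proof.
move=> PhiX initt b lb eb x y.
have [p Pp] : exists p : {p | prime p}, partition_lengths X (sval p).
  apply: contrapT => noP; apply: PhiX; apply: funext => p.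
  apply: natinf_le_antisym; last by case: (Phi _ p).
  apply: natinf_leP => -[//|k] /ultradvd_pfactor Pk.
  exfalso; apply: noP; exists p.
  by rewrite partition_lengths_Phi; apply: ultradvd_dvd Pk; exact: dvdn_exp.
have p1 : (1 < sval p)%N := prime_gt1 (svalP p).
have /partition_lengthsP[p0 [c pc]] := Pp.
(* The cyclic system [Z/p], as the odometer on a constant sequence. *)
pose n := OdoSeq (fun=> p0) (fun=> dvdnn (sval p)).
have pbc : phase (sval p) (fun z => b z + c z)%N.
  apply: phase_addl => //; last by move=> z; rewrite eb.
  by move=> z; apply: filterS (lb z) => w ->.
have lift (e : X -> nat) : phase (sval p) e ->
    exists2 k : target t -> nat, phase (sval p) k &
      forall z, k (sval (leg t) z) = e z %[mod sval p].
  move=> pe; have [//|h hE] := @odo_lift n X (fun=> e) (fun=> pe).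
  have [u] := initt (odometer_factor h).
  have [k kE] := factor_hom_leg u.
  exists (@odo_coord n 0 \o sval k).
    exact: phase_comp (odo_coord_phase n 0).
  move=> z; rewrite -[RHS]modn_mod -(hE z 0%N).
  by rewrite [h](kE : h = dynhom_comp k (leg t)).
have [k pk kE] := lift _ pc; have [l pl lE] := lift _ pbc.
have pbk : phase (sval p) (fun a => b x + k a)%N.
  apply: (@phase_addl _ _ _ (fun=> nat_of_bool (b x))) => // z.
  exact: filterE.
have bkE z : b x + k (sval (leg t) z) = b x + c z %[mod sval p].
  by rewrite -modnDmr kE modnDmr.
have := phase_rigid (sval (leg t) x) (sval (leg t) y)
  (odometer_like_invariants (target_odometer_like t)) pbk pl.
rewrite bkE lE => /(_ erefl); rewrite bkE lE => /eqP.
rewrite eqn_modDr !modn_small ?(leq_ltn_trans (leq_b1 _)) //.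
by case: (b x) (b y) => [] [].
Qed.

End FactorCategoryOf.

(** * The skeleton and the order *)

Lemma order_cat_thin (S : set ultranat) (a b : Obj (order_cat S))
    (u v : Hom a b) : u = v.
Proof. exact: (@Prop_irrelevance (ultranat_le (sval b) (sval a))). Qed.

Section Skeleton.
Variables (X : dynsys) (B0 : Obj (factor_cat X) -> Prop).
Hypothesis skelB0 : is_skeleton B0.

Lemma skeleton_eq (a b : Obj (full_subcat B0)) :
  isomorphic (sval a) (sval b) -> a = b.
Proof.
move=> ab; apply: eq_sig_hprop => [? ? ?|]; first exact: Prop_irrelevance.
have [r [_ uniq_r]] := skelB0 (sval a).
rewrite -(uniq_r (sval a)) ?(uniq_r (sval b)) //.
  by split=> //; exact: svalP.
split; first exact: svalP.
by exists (idm _), (idm _); split; exact: factor_hom_unique.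
Qed.

Lemma skeleton_repr (o : Obj (factor_cat X)) :
  exists r : Obj (full_subcat B0), isomorphic o (sval r).
Proof. by have [r [[Br or] _]] := skelB0 o; exists (exist _ r Br). Qed.

Definition Phi_functor : functor (full_subcat B0) (order_cat (Sigma X)) :=
  @Functor (full_subcat B0) (order_cat (Sigma X))
    (fun a => exist (Sigma X) (Phi (partition_lengths (target (sval a))))
                    (Phi_target_le (sval a)))
    (fun a b u => Phi_hom (sval u))
    (fun=> order_cat_thin _ _) (fun _ _ _ _ _ => order_cat_thin _ _).

Lemma Phi_functor_bijective :
  invariants_const X -> bijective (fobj Phi_functor).
Proof.
move=> invX; apply: inj_surj_bij => [a b /(congr1 sval) /= e|[N XN]].
  have [u] : inhabited (factor_hom (sval a) (sval b)).
    by apply: factor_hom_ex => //; rewrite e; exact: ultranat_le_refl.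
  have [v] : inhabited (factor_hom (sval b) (sval a)).
    by apply: factor_hom_ex => //; rewrite e; exact: ultranat_le_refl.
  by apply: skeleton_eq; exists u, v; split; exact: factor_hom_unique.
have [o oN] := factor_obj_ex invX XN.
have [r [u [v _]]] := skeleton_repr o; exists r.
apply: eq_sig_hprop => [? ? ?|]; first exact: Prop_irrelevance.
rewrite /= -oN; apply: ultranat_le_antisym; first exact: Phi_hom (sval u).
exact: Phi_hom (sval v).
Qed.

End Skeleton.

Theorem theorem4p2 (X : dynsys)
    (PhiX : Phi (partition_lengths X) <> ultranat0)
    (B0 : Obj (factor_cat X) -> Prop) (skelB0 : is_skeleton B0) :
  indecomposable X <->
  isomorphic_categories (full_subcat B0) (order_cat (Sigma X)).
Proof.
split=> [/indecomposableP invX|[F [bijF bijFF]]].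
  apply: (@thin_isomorphic_categories _ _ (Phi_functor B0)).
  - by move=> a b; exact: factor_hom_unique.
  - exact: order_cat_thin.
  - exact: Phi_functor_bijective.
  - by move=> a b; exact: factor_hom_ex.
have [G FK GK] := bijF.
pose top : Obj (order_cat (Sigma X)) :=
  exist (Sigma X) (Phi (partition_lengths X)) (ultranat_le_refl _).
apply/indecomposableP.
apply: (@weakly_initial_invariants X (sval (G top))) => // o.
have [r [_ [v _]]] := skeleton_repr skelB0 o.
have [|u] := isomorphism_full bijF bijFF (a := G top) (b := r).
  by rewrite GK; exact: (svalP (fobj F r)).
by constructor; exact: (factor_comp v u).
Qed.
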